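(* For $\sigma>0$ let $$m_{\mathcal A}(s)=2\|s\|^2+8(s_1s_2+s_1s_3+s_2s_3)+\frac{\sigma}{4}(s_1^4+s_2^4+s_3^4),\qquad s\in\mathbb{R}^3,$$ and denote its global minimum value by $m_{\mathcal A}(s^* )$. Then, for every $\sigma>0$, the polynomial $m_{\mathcal A}(s)-m_{\mathcal A}(s^* )$ is nonnegative on $\mathbb{R}^3$ but is not a sum of squares of polynomials.
   Context: $\|\cdot\|$ is the Euclidean norm on $\mathbb{R}^3$. *)

(* Defs.v *)
From mathcomp Require Import all_boot all_order all_algebra.
From mathcomp Require Import mpoly.
From mathcomp Require Import reals.

Set Implicit Arguments.
Unset Strict Implicit.
Unset Printing Implicit Defensive.

Import Order.TTheory GRing.Theory Num.Theory.
Local Open Scope ring_scope.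

(* Points of R^n are functions 'I_n -> R, the argument type of the
   evaluation p.@[s]; for n = 3 the coordinates s_1, s_2, s_3 are
   s 0, s 1, s 2, with 0, 1, 2 : 'I_3. *)
Definition euclidean_norm (R : realType) (n : nat) (s : 'I_n -> R) : R :=
  Num.sqrt (\sum_(i < n) s i ^+ 2).

Definition mA (R : realType) (sigma : R) (s : 'I_3 -> R) : R :=
  2 * euclidean_norm s ^+ 2
  + 8 * (s 0 * s 1 + s 0 * s 2 + s 1 * s 2)
  + sigma / 4 * (s 0 ^+ 4 + s 1 ^+ 4 + s 2 ^+ 4).

Definition mA_poly (R : realType) (sigma : R) : {mpoly R[3]} :=
  2 *: (\sum_(i < 3) 'X_i ^+ 2)
  + 8 *: ('X_0 * 'X_1 + 'X_0 * 'X_2 + 'X_1 * 'X_2)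
  + (sigma / 4) *: ('X_0 ^+ 4 + 'X_1 ^+ 4 + 'X_2 ^+ 4).

Lemma mA_polyE (R : realType) (sigma : R) (s : 'I_3 -> R) :
  (mA_poly sigma).@[s] = mA sigma s.
Proof.
rewrite /mA /euclidean_norm sqr_sqrtr; last first.
  by apply: sumr_ge0 => i _; exact: sqr_ge0.
by rewrite /mA_poly !big_ord_recr !big_ord0 /= !exprS !expr0 !mulr1
  !(mevalD, mevalZ, mevalM, mevalXU, meval0).
Qed.

Definition is_global_minimizer (R : realType) (n : nat)
    (f : ('I_n -> R) -> R) (s : 'I_n -> R) : Prop :=
  forall t : 'I_n -> R, f s <= f t.

Definition is_sos (R : realType) (n : nat) (p : {mpoly R[n]}) : Prop :=
  exists qs : seq {mpoly R[n]}, p = \sum_(q <- qs) q ^+ 2.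

(* Main.v *)
Require Import Defs.
From mathcomp Require Import all_boot all_order all_algebra.
From mathcomp Require Import mpoly ssrcomplements.
From mathcomp Require Import reals.
From mathcomp Require Import ring lra.

Import Order.TTheory GRing.Theory Num.Theory.
Local Open Scope ring_scope.

(** Write e1 = s_1 + s_2 + s_3 and p_k for the power sums, so that
    m = 4 e1^2 - 2 p_2 + (sigma / 4) p_4.

    The minimum. Among the triples with given e1 and p_2, the power sum p_4 is
    smallest at one of the form (a, a, b) (two_equal), so m need only be
    minimized there, where m = 12 a^2 + 16 a b + 2 b^2
    + sigma (a^4 / 2 + b^4 / 4). For every c > 0,
    16 a b >= - 8 (c a^2 + b^2 / c), with equality iff b = - c a; what remains
    is a sum of one quadratic function of a^2 and one of b^2, minimal at
    sigma a^2 = 8 c - 12 and sigma b^2 = 16 / c - 4. These values satisfy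
    b^2 = c^2 a^2 exactly when 2 c^4 - 3 c^3 + c - 4 = 0, that is
    (c + 1) (2 c^3 - 5 c^2 + 5 c - 4) = 0, and the cubic factor has a root in
    ]3/2, 2[. Hence (a, a, - c a) is a global minimizer (mA_minimizer), and so
    are its permutations and their opposites, since m is symmetric and even.

    No sum of squares. Suppose m - min m is a sum of squares. Leading terms
    cannot cancel, so each squared polynomial q has degree at most 2
    (msize_sos); and q vanishes at the six minimizers above (sos_root). Let a_i
    be the coefficient of s_i^2 in q and b_i that of the product of the two
    other variables. Vanishing at two opposite points kills the even part of q
    there, and subtracting these equations for two permutations yields
    b_i - b_j = (1 - c) (a_i - a_j). Under these relations a fixed linear
    functional on quartic forms, with k = c (c - 1), takes at the leading form
    of q^2 the value (2 - k) (a_1 + a_2 + a_3)^2 >= 0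
    (certificate_square_ge0). At the leading form
    (sigma / 4) (s_1^4 + s_2^4 + s_3^4) of m it takes the value
    (3 sigma / 4) (2 - 3 k), which is negative because c > 3/2 gives
    k > 3/4. *)

(** * Degrees of the terms of a sum of squares *)

(** Squares have nonnegative coefficients at twice the largest leading
    monomial M, so that monomial survives in the sum. *)
Lemma mlead_sos (R : realDomainType) (n : nat) (qs : seq {mpoly R[n]}) q :
  q \in qs ->
  ((mlead q + mlead q)%MM <= mlead (\sum_(p <- qs) p ^+ 2))%O.
Proof.
move=> q_qs; pose M := (\join_(p <- qs) mlead p)%O.
have leM p : p \in qs -> (mlead p <= M)%O by move=> ?; apply/joins_sup_seq.
have coefM : (\sum_(p <- qs) p ^+ 2)@_(M + M) = \sum_(p <- qs) p@_M ^+ 2.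
  rewrite raddf_sum /= big_seq [RHS]big_seq; apply: eq_bigr => p p_qs.
  by rewrite !expr2 mleadcMW // leM.
have leMM : ((mlead q + mlead q)%MM <= (M + M)%MM)%O.
  by apply: lem_add; apply: leM.
apply: (le_trans leMM); rewrite leNgt; apply/negP => ltM.
have [p p_qs pM] : exists2 p, p \in qs & mlead p = M.
  have qs0 : qs != [::] by case: (qs) q_qs.
  have [p p_qs /eqP pM] := eq_bigjoin (@mlead _ _) le_total qs0.
  by exists p.
move/mcoeff_gt_mlead/eqP: (ltM).
rewrite coefM psumr_eq0 => [/allP/(_ p p_qs)|? _]; last exact: sqr_ge0.
rewrite sqrf_eq0 -pM mleadc_eq0 => /eqP p0.
by move: ltM; rewrite -pM p0 mlead0 addm0 ltNge le0x.
Qed.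

Lemma msize_sos (R : realDomainType) (n k : nat) (qs : seq {mpoly R[n]}) q :
  q \in qs -> (msize (\sum_(p <- qs) p ^+ 2) <= k.*2.+1)%N ->
  (msize q <= k.+1)%N.
Proof.
move=> q_qs le_k; have [->|q0] := eqVneq q 0; first by rewrite msize0.
have := lemc_mdeg (mlead_sos _ _ _ _ q_qs); rewrite mdegD addnn => le_q.
rewrite -mlead_deg // ltnS -leq_double (leq_trans le_q) //.
move: le_k; set s := \sum_(p <- qs) _.
have [->|s0] := eqVneq s 0; first by rewrite mlead0 mdeg0.
by rewrite -mlead_deg // ltnS.
Qed.

Lemma sos_root (R : realDomainType) (n : nat) (qs : seq {mpoly R[n]}) s :
  (\sum_(q <- qs) q ^+ 2).@[s] = 0 -> forall q, q \in qs -> q.@[s] = 0.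
Proof.
move=> /eqP; rewrite raddf_sum /= psumr_eq0 => [/allP qs0 q /qs0|q _].
  by rewrite rmorphXn /= sqrf_eq0 => /eqP.
by rewrite rmorphXn sqr_ge0.
Qed.

(** * Points and quadratic polynomials in three variables *)

Definition pt {R : nzRingType} (x y z : R) : 'I_3 -> R :=
  fun i => [:: x; y; z]`_i.

(** The index of b_i is that of the variable missing from the product, which
    makes the symmetry between the coefficients visible. *)
Lemma quadratic_meval (R : comNzRingType) (q : {mpoly R[3]}) :
  (msize q <= 3)%N ->
  exists c l1 l2 l3 a1 a2 a3 b1 b2 b3 : R, forall x y z,
    q.@[pt x y z] = c + l1 * x + l2 * y + l3 * z
      + a1 * x ^+ 2 + a2 * y ^+ 2 + a3 * z ^+ 2
      + b1 * (y * z) + b2 * (x * z) + b3 * (x * y).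
Proof.
move=> q3; rewrite [q]mpolyE big_seq.
apply: (big_ind (fun p : {mpoly R[3]} =>
  exists c l1 l2 l3 a1 a2 a3 b1 b2 b3 : R, forall x y z,
    p.@[pt x y z] = c + l1 * x + l2 * y + l3 * z
      + a1 * x ^+ 2 + a2 * y ^+ 2 + a3 * z ^+ 2
      + b1 * (y * z) + b2 * (x * z) + b3 * (x * y))).
- by do 10 exists 0; move=> x y z; rewrite meval0; ring.
- move=> p p' [c [l1 [l2 [l3 [a1 [a2 [a3 [b1 [b2 [b3 E]]]]]]]]]]
             [c' [l1' [l2' [l3' [a1' [a2' [a3' [b1' [b2' [b3' E']]]]]]]]]].
  exists (c + c'), (l1 + l1'), (l2 + l2'), (l3 + l3'), (a1 + a1'), (a2 + a2'),
    (a3 + a3'), (b1 + b1'), (b2 + b2'), (b3 + b3') => x y z.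
  by rewrite mevalD E E'; ring.
- move=> m /msize_mdeg_lt m_q; have {m_q q3} := leq_trans m_q q3.
  set d := q@_m; clearbody d.
  rewrite mdegE !big_ord_recr big_ord0 /= add0n.
  set i := m _; set j := m _; set k := m _ => ijk.
  have E x y z : (d *: 'X_[m]).@[pt x y z] = d * (x ^+ i * y ^+ j * z ^+ k).
    by rewrite mevalZ mevalX !big_ord_recr big_ord0 /= mul1r.
  move: ijk E; clearbody i j k.
  case: i => [|[|[|i]]]; case: j => [|[|[|j]]]; case: k => [|[|[|k]]] //= _ E.
  + by exists d, 0, 0, 0, 0, 0, 0, 0, 0, 0 => x y z; rewrite E; ring.
  + by exists 0, 0, 0, d, 0, 0, 0, 0, 0, 0 => x y z; rewrite E; ring.
  + by exists 0, 0, 0, 0, 0, 0, d, 0, 0, 0 => x y z; rewrite E; ring.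
  + by exists 0, 0, d, 0, 0, 0, 0, 0, 0, 0 => x y z; rewrite E; ring.
  + by exists 0, 0, 0, 0, 0, 0, 0, d, 0, 0 => x y z; rewrite E; ring.
  + by exists 0, 0, 0, 0, 0, d, 0, 0, 0, 0 => x y z; rewrite E; ring.
  + by exists 0, d, 0, 0, 0, 0, 0, 0, 0, 0 => x y z; rewrite E; ring.
  + by exists 0, 0, 0, 0, 0, 0, 0, 0, d, 0 => x y z; rewrite E; ring.
  + by exists 0, 0, 0, 0, 0, 0, 0, 0, 0, d => x y z; rewrite E; ring.
  + by exists 0, 0, 0, 0, d, 0, 0, 0, 0, 0 => x y z; rewrite E; ring.
Qed.

(** * A separating linear functional *)

(** The centred fourth difference of t |-> F (t v) at 0 with step 1, divided by
    4!: for a polynomial F of degree at most 4, the value at v = (x, y, z) of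
    its homogeneous part of degree 4. It depends linearly on the values of F,
    so it passes through sums of squares without any choice of coefficients. *)
Definition quartic_part {R : fieldType} (F : ('I_3 -> R) -> R) (x y z : R)
    : R :=
  (F (pt (2 * x) (2 * y) (2 * z)) + F (pt (- (2 * x)) (- (2 * y)) (- (2 * z)))
   - 4 * (F (pt x y z) + F (pt (- x) (- y) (- z))) + 6 * F (pt 0 0 0)) / 24.

(** For a quartic form H, let S_4, S_22, S_31, S_211 be the sums of its
    coefficients at the monomials of types x^4, x^2 y^2, x^3 y, x^2 y z. This
    is (2 - 3 k) S_4 + 2 S_22 + S_31 / 2 - S_211, rewritten with values of H
    at points: the values at e_i + e_j sum to 2 S_4 + S_22 + S_31, those at
    e_i - e_j to 2 S_4 + S_22 - S_31, and H(1, 1, 1) is the sum of all four.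
    The weights are those for which its value at the square of a quadratic
    polynomial vanishing at the six minimizers is a multiple of the square of
    the sum of the coefficients of x^2, y^2, z^2. *)
Definition certificate {R : fieldType} (k : R) (F : ('I_3 -> R) -> R) : R :=
  let H := quartic_part F in
  - (3 * (1 + k)) * (H 1 0 0 + H 0 1 0 + H 0 0 1)
  + 9 / 4 * (H 0 1 1 + H 1 0 1 + H 1 1 0)
  + 3 / 4 * (H 0 1 (- 1) + H 1 0 (- 1) + H 1 (- 1) 0)
  - H 1 1 1.

Lemma eq_certificate (R : fieldType) (k : R) (F G : ('I_3 -> R) -> R) :
  F =1 G -> certificate k F = certificate k G.
Proof. by move=> FG; rewrite /certificate /quartic_part !FG. Qed.

Lemma certificate_sum (R : fieldType) (k : R) (I : Type) (r : seq I)
    (F : I -> ('I_3 -> R) -> R) :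
  certificate k (fun s => \sum_(i <- r) F i s)
  = \sum_(i <- r) certificate k (F i).
Proof.
elim: r => [|i r IHr].
  by rewrite big_nil /certificate /quartic_part !big_nil; ring.
by rewrite big_cons -IHr /certificate /quartic_part !big_cons; ring.
Qed.

(** The zeros of q force b_i - b_j = (1 - c) (a_i - a_j) on its quadratic
    coefficients. Hence the (b_i - b_j)^2 and the (a_i - a_j) (b_i - b_j),
    summed over pairs, are (1 - c)^2 and (1 - c) times the sum of the
    (a_i - a_j)^2. With S_4, S_22, S_31, S_211 taken for the square of q, all
    three sums are combinations of these, of the sum of the a_i b_i and of
    (a_1 + a_2 + a_3)^2; eliminating the sum of the a_i b_i from the two
    relations gives the value of the functional. *)
Lemma certificate_square_ge0 (R : realFieldType) (a c : R)
    (q : {mpoly R[3]}) :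
  a != 0 -> 1 < c < 2 -> (msize q <= 3)%N ->
  let b := - (c * a) in
  [/\ q.@[pt a a b] = 0, q.@[pt a b a] = 0 & q.@[pt b a a] = 0] ->
  [/\ q.@[pt (- a) (- a) (- b)] = 0, q.@[pt (- a) (- b) (- a)] = 0
    & q.@[pt (- b) (- a) (- a)] = 0] ->
  0 <= certificate (c * (c - 1)) (fun s => q.@[s] ^+ 2).
Proof.
move=> a0 /andP[c1 c2] q3 b [].
have [c0 [l1 [l2 [l3 [a1 [a2 [a3 [b1 [b2 [b3 E]]]]]]]]]] :=
  quadratic_meval _ _ q3.
(* The linear and constant terms of q do not reach degree 4 in q^2. *)
have top x y z : quartic_part (fun s => q.@[s] ^+ 2) x y z =
    (a1 * x ^+ 2 + a2 * y ^+ 2 + a3 * z ^+ 2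
     + b1 * (y * z) + b2 * (x * z) + b3 * (x * y)) ^+ 2.
  by rewrite /quartic_part !E; field.
rewrite !E /b => z1 z2 z3 [z4 z5 z6].
have nz : (c + 1) * a ^+ 2 != 0.
  by rewrite mulf_neq0 ?sqrf_eq0 // gt_eqF //; lra.
(* Each equation is half the sum of the equations at two opposite points for
   one permutation, minus the same for another permutation. *)
have d1 : b1 = b3 + (1 - c) * (a1 - a3).
  by apply: (mulfI nz); lra.
have d2 : b2 = b3 + (1 - c) * (a2 - a3).
  by apply: (mulfI nz); lra.
have -> : certificate (c * (c - 1)) (fun s => q.@[s] ^+ 2)
    = (2 - c * (c - 1)) * (a1 + a2 + a3) ^+ 2.
  by rewrite /certificate !top d1 d2; field.
by rewrite mulr_ge0 ?sqr_ge0 //; nra.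
Qed.

(** * The global minimum *)

(** Center the triple by subtracting its mean. Fixing e1 and p_2 fixes p_4 up to
    the summand 4 e1 d, with d the product of the centered coordinates, and the
    discriminant being nonnegative bounds d by its values at the triples with a
    double entry; the sign of e1 decides which of the two extremal triples is
    taken. *)
Lemma two_equal (R : rcfType) (x y z : R) :
  exists a b : R, [/\ 2 * a + b = x + y + z,
    2 * a ^+ 2 + b ^+ 2 = x ^+ 2 + y ^+ 2 + z ^+ 2
  & 2 * a ^+ 4 + b ^+ 4 <= x ^+ 4 + y ^+ 4 + z ^+ 4].
Proof.
pose s := x + y + z.
pose u := x - s / 3; pose v := y - s / 3.
pose D := u ^+ 2 + u * v + v ^+ 2.
have D0 : 0 <= D by rewrite /D; nra.
pose e := u * v * (u + v).
(* The difference is the discriminant of the monic cubic whose roots are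
   u, v and - (u + v). *)
have De : 27 * e ^+ 2 <= 4 * D ^+ 3.
  rewrite -subr_ge0 (_ : _ - _ = ((u - v) * (2 * u + v) * (u + 2 * v)) ^+ 2).
    exact: sqr_ge0.
  by rewrite /D /e; ring.
(* The extremal centered triple (w, w, - 2 w) has the same quadratic invariant
   D, and its product - 2 w^3 has the sign opposite to that of s. *)
have [w wD sw] : exists2 w, 3 * w ^+ 2 = D & 0 <= s * w.
  have r0 := sqrtr_ge0 (D / 3).
  have r2 : 3 * Num.sqrt (D / 3) ^+ 2 = D by rewrite sqr_sqrtr; lra.
  case: (lerP 0 s) => s0.
    by exists (Num.sqrt (D / 3)) => //; rewrite mulr_ge0.
  exists (- Num.sqrt (D / 3)); first by rewrite sqrrN.
  by rewrite mulrN -mulNr mulr_ge0 // oppr_ge0 ltW.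
have ew : s * e <= 2 * (s * w) * w ^+ 2.
  apply: le_trans (ler_norm _) _.
  rewrite -ler_sqr ?nnegrE //; last first.
    by rewrite mulr_ge0 ?sqr_ge0 // mulr_ge0.
  rewrite real_normK ?num_real // -wD in De *.
  have -> : (2 * (s * w) * w ^+ 2) ^+ 2 = s ^+ 2 * (4 * w ^+ 6) by ring.
  rewrite exprMn ler_wpM2l ?sqr_ge0 //.
  by move: De; rewrite exprMn; lra.
exists (s / 3 + w), (s / 3 - 2 * w); split.
- by rewrite /s; field.
- rewrite (_ : _ + _ = s ^+ 2 / 3 + 2 * (3 * w ^+ 2)); last by field.
  by rewrite wD /D /u /v /s; field.
- rewrite -subr_ge0.
  rewrite (_ : _ - _ = 4 * (2 * (s * w) * w ^+ 2 - s * e)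
     + 2 * (D - 3 * w ^+ 2) * (D + 3 * w ^+ 2 + 2 * s ^+ 2 / 3)).
    by rewrite wD subrr mulr0 mul0r; lra.
  by rewrite /D /e /u /v /s; field.
Qed.

(** The ratio c = - b / a at which the bound on 16 a b and the minima of the
    two quadratic functions of a^2 and of b^2 are attained together. *)
Lemma balance_exists (R : rcfType) :
  exists2 c : R, 3 / 2 < c < 2 & 2 * c ^+ 3 - 5 * c ^+ 2 + 5 * c - 4 = 0.
Proof.
pose p : {poly R} := 2%:P * 'X^3 - 5%:P * 'X^2 + 5%:P * 'X - 4%:P.
have pE x : p.[x] = 2 * x ^+ 3 - 5 * x ^+ 2 + 5 * x - 4 by rewrite /p !hornerE.
have [||c /andP[c1 c2] /rootP] := @poly_ivt R p (3 / 2) 2.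
- lra.
- by rewrite !pE; apply/andP; split; lra.
rewrite pE => c0; exists c => //.
apply/andP; split; rewrite lt_neqAle ?c1 ?c2 andbT; apply/eqP => cE.
  by move: c0; rewrite -cE; lra.
by move: c0; rewrite cE; lra.
Qed.

Lemma mA_ptE (R : realType) (sigma x y z : R) : mA sigma (pt x y z) =
  2 * (x ^+ 2 + y ^+ 2 + z ^+ 2) + 8 * (x * y + x * z + y * z)
  + sigma / 4 * (x ^+ 4 + y ^+ 4 + z ^+ 4).
Proof.
rewrite /mA /euclidean_norm sqr_sqrtr; last first.
  by apply: sumr_ge0 => i _; exact: sqr_ge0.
by rewrite !big_ord_recr big_ord0 /= add0r.
Qed.

Lemma mA_eta (R : realType) (sigma : R) (s : 'I_3 -> R) :
  mA sigma s = mA sigma (pt (s 0) (s 1) (s 2)).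
Proof.
rewrite -!mA_polyE; apply: meval_eq => -[[|[|[|//]]] i3]; rewrite /pt /=;
  by congr s; apply: val_inj.
Qed.

(** Completing the squares: the three squares vanish together at
    (a, - c a). *)
Lemma mA_two_equalE (R : realType) (sigma a c x y : R) : 0 < c ->
  2 * c ^+ 3 - 5 * c ^+ 2 + 5 * c - 4 = 0 -> sigma * a ^+ 2 = 8 * c - 12 ->
  mA sigma (pt x x y) = 8 / c * (c * x + y) ^+ 2
    + sigma / 2 * (x ^+ 2 - a ^+ 2) ^+ 2
    + sigma / 4 * (y ^+ 2 - (c * a) ^+ 2) ^+ 2
    - sigma / 4 * (2 * a ^+ 4 + (c * a) ^+ 4).
Proof.
move=> c_gt0 c_root a2; rewrite mA_ptE.
have c0 : c != 0 by rewrite gt_eqF.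
(* Multiplied by c, the two sides differ by 4 (c + 1) times the cubic at c. *)
have b2 : sigma * (c * a) ^+ 2 = 16 / c - 4.
  apply: (mulfI c0); rewrite [RHS](_ : _ = 16 - 4 * c); last by field.
  rewrite [LHS](_ : _ = c ^+ 3 * (sigma * a ^+ 2)); last by ring.
  rewrite a2; apply/eqP; rewrite -subr_eq0.
  rewrite (_ : _ - _ = 4 * (c + 1) * (2 * c ^+ 3 - 5 * c ^+ 2 + 5 * c - 4)).
    by rewrite c_root mulr0.
  by ring.
apply/eqP; rewrite -subr_eq0.
rewrite (_ : _ - _ = x ^+ 2 * (sigma * a ^+ 2 - (8 * c - 12))
   + y ^+ 2 / 2 * (sigma * (c * a) ^+ 2 - (16 / c - 4))).
  by rewrite a2 b2 !subrr !mulr0 addr0.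
by field.
Qed.

Lemma mA_minimizer (R : realType) (sigma a c : R) : 0 < sigma -> 0 < c ->
  2 * c ^+ 3 - 5 * c ^+ 2 + 5 * c - 4 = 0 -> sigma * a ^+ 2 = 8 * c - 12 ->
  is_global_minimizer (mA sigma) (pt a a (- (c * a))).
Proof.
move=> sigma0 c0 c_root a2 t.
have [x [y [e1 e2 e4]]] := two_equal _ (t 0) (t 1) (t 2).
apply: (@le_trans _ _ (mA sigma (pt x x y))).
  rewrite !(mA_two_equalE _ _ _ _ _ _ c0 c_root a2) lerD2r.
  rewrite subrr sqrrN subrr subrr expr0n /= !mulr0 !addr0.
  by rewrite !addr_ge0 // mulr_ge0 ?sqr_ge0 // divr_ge0 // ltW.
rewrite (mA_eta _ _ t) !mA_ptE -subr_ge0.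
rewrite (_ : _ - _ = 4 * ((t 0 + t 1 + t 2) ^+ 2 - (2 * x + y) ^+ 2)
   - 2 * (t 0 ^+ 2 + t 1 ^+ 2 + t 2 ^+ 2 - (2 * x ^+ 2 + y ^+ 2))
   + sigma / 4 * (t 0 ^+ 4 + t 1 ^+ 4 + t 2 ^+ 4 - (2 * x ^+ 4 + y ^+ 4))).
  rewrite e1 e2 !subrr !mulr0 subrr add0r.
  by rewrite mulr_ge0 ?subr_ge0 // divr_ge0 // ltW.
by field.
Qed.

(** * Assembling the two parts *)

Lemma msize_mA_poly (R : realType) (sigma m : R) :
  (msize (mA_poly sigma - m%:MP) <= 5)%N.
Proof.
have msizeXn (i : 'I_3) k : msize ('X_i ^+ k : {mpoly R[3]}) = k.+1.
  by rewrite mpolyXn msizeX mdegMn mdeg1 mul1n.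
have msizeXX (i j : 'I_3) : msize ('X_i * 'X_j : {mpoly R[3]}) = 3%N.
  by rewrite -mpolyXD msizeX mdegD !mdeg1.
have leD (p q : {mpoly R[3]}) :
    (msize p <= 5 -> msize q <= 5 -> msize (p + q) <= 5)%N.
  by move=> p5 q5; rewrite (leq_trans (msizeD_le _ _)) // geq_max p5.
rewrite /mA_poly !big_ord_recr big_ord0 /= add0r.
have leZ (d : R) (p : {mpoly R[3]}) :
    (msize p <= 5 -> msize (d *: p) <= 5)%N.
  by move=> p5; rewrite (leq_trans (msizeZ_le _ _)).
apply: (leD); last by rewrite msizeN msizeC; case: eqP.
by repeat first [apply: (leD) | apply: (leZ)]; rewrite ?msizeXn ?msizeXX.
Qed.

Theorem lemma3p3 (R : realType) (sigma : R) (hsigma : 0 < sigma) :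
  (exists sstar : 'I_3 -> R, is_global_minimizer (mA sigma) sstar) /\
  (forall sstar : 'I_3 -> R, is_global_minimizer (mA sigma) sstar ->
     (forall s : 'I_3 -> R,
        0 <= (mA_poly sigma - (mA sigma sstar)%:MP).@[s]) /\
     ~ is_sos (mA_poly sigma - (mA sigma sstar)%:MP)).
Proof.
have [c /andP[c1 c2] c_root] := balance_exists R.
have c0 : 0 < c by lra.
pose a := Num.sqrt ((8 * c - 12) / sigma).
have aS : 0 < (8 * c - 12) / sigma by rewrite divr_gt0 //; lra.
have a0 : a != 0 by rewrite gt_eqF // sqrtr_gt0.
have a2 : sigma * a ^+ 2 = 8 * c - 12.
  by rewrite sqr_sqrtr ?ltW // mulrC divfK // gt_eqF.
have min := mA_minimizer _ _ _ _ hsigma c0 c_root a2.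
split; first by exists (pt a a (- (c * a))).
move=> sstar sstar_min; split=> [s|[qs E]].
  by rewrite mevalB mevalC mA_polyE subr_ge0 sstar_min.
have root0 s : mA sigma s = mA sigma (pt a a (- (c * a))) ->
    forall q, q \in qs -> q.@[s] = 0.
  move=> sE; apply: sos_root; rewrite -E mevalB mevalC mA_polyE sE.
  by apply/eqP; rewrite subr_eq0 eq_le min sstar_min.
have : 0 <= certificate (c * (c - 1))
              (fun s => (mA_poly sigma - (mA sigma sstar)%:MP).@[s]).
  rewrite E (@eq_certificate _ _ _ (fun s => \sum_(q <- qs) q.@[s] ^+ 2)).
    rewrite certificate_sum big_seq sumr_ge0 // => q q_qs.
    apply: (certificate_square_ge0 _ a) => //; first by apply/andP; split; lra.
    - by apply: msize_sos q_qs _; rewrite -E msize_mA_poly.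
    - by split; apply: root0 q_qs; rewrite !mA_ptE; ring.
    - by split; apply: root0 q_qs; rewrite !mA_ptE; ring.
  by move=> s; rewrite raddf_sum /=; apply: eq_bigr => q _; rewrite rmorphXn.
rewrite (@eq_certificate _ _ _ (fun s => mA sigma s - mA sigma sstar));
  last first.
  by move=> s; rewrite mevalB mevalC mA_polyE.
rewrite /certificate /quartic_part !mA_ptE.
set L := (X in 0 <= X).
have -> : L = 3 * sigma / 4 * (2 - 3 * (c * (c - 1))) by rewrite /L; field.
apply/negP; rewrite -ltNge pmulr_rlt0; first by nra.
by rewrite divr_gt0 // mulr_gt0.
Qed.
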